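(* Let $\mathcal{R}$ be a ring with unit $1\neq 0$ and with an involution $x\mapsto x^*$. Let $a,b,c,\widetilde{b}\in\mathcal{R}$ be such that $a\{1,3\}\neq\emptyset$ and $c\{1,4\}\neq\emptyset$, and such that $abc$ is right $*$-cancellable. Let $a^{(1,2,3)}\in a\{1,2,3\}$ and $c^{(1,2,4)}\in c\{1,2,4\}$ be given such that $c^{(1,2,4)}\widetilde{b}a^{(1,2,3)}$ is left $*$-cancellable, and put $p=a^{(1,2,3)}abcc^{(1,2,4)}$ and $q=cc^{(1,2,4)}\widetilde{b}a^{(1,2,3)}a$. Then the following conditions are equivalent: (i) $abc$ is Moore-Penrose invertible and $(abc)^{\dagger}=c^{(1,2,4)}\widetilde{b}a^{(1,2,3)}$; (ii) $q\in p\{1,2\}$ and both of $a^*apq$ and $qpcc^*$ are Hermitian; (iii) $q\in p\{1,2\}$ and both of $a^*apq$ and $qpcc^*$ are EP; (iv) $pq=(pq)^2$, $a^*ap\mathcal{R}\supseteq q^*\mathcal{R}$ and $cc^*p^*\mathcal{R}\subseteq q\mathcal{R}$; (v) $pq=(pq)^2$, $a^*ap\mathcal{R}\subseteq q^*\mathcal{R}$ and $cc^*p^*\mathcal{R}\supseteq q\mathcal{R}$.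
   Context: $\mathcal{R}$ is a (not necessarily commutative) ring with unit $1\neq 0$ and an involution $x\mapsto x^*$, i.e. $(x^* )^*=x$, $(x+y)^*=x^*+y^*$, $(xy)^*=y^*x^*$ for all $x,y\in\mathcal{R}$. For $x\in\mathcal{R}$, the four Penrose equations for $y\in\mathcal{R}$ are: (1) $xyx=x$; (2) $yxy=y$; (3) $(xy)^*=xy$; (4) $(yx)^*=yx$. The element $x$ is Moore-Penrose invertible if some $y\in\mathcal{R}$ satisfies all four; such $y$ is then unique and denoted $x^\dagger$. For a set of indices, $x\{i,\ldots,j\}$ denotes the set of all $y\in\mathcal{R}$ satisfying equations $(i),\ldots,(j)$, and $x^{(i,\ldots,j)}$ denotes an element of $x\{i,\ldots,j\}$. An element $x\in\mathcal{R}$ is left $*$-cancellable if for all $z\in\mathcal{R}$, $x^*xz=0$ implies $xz=0$, and right $*$-cancellable if for all $z\in\mathcal{R}$, $zxx^*=0$ implies $zx=0$. For $x\in\mathcal{R}$, $x\mathcal{R}=\{xr: r\in\mathcal{R}\}$. An element $x$ is Hermitian if $x^*=x$, and EP if $x\mathcal{R}=x^*\mathcal{R}$. *)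

(* Defs.v *)
From HB Require Import structures.
From mathcomp Require Import all_boot all_algebra.
From mathcomp Require Import boolp classical_sets.
Set Implicit Arguments.
Unset Strict Implicit.
Unset Printing Implicit Defensive.
Import GRing.Theory.
Local Open Scope classical_set_scope.
Local Open Scope ring_scope.

Definition ring_involution (R : nzRingType) (star : R -> R) : Prop :=
  [/\ involutive star,
      {morph star : x y / x + y} &
      forall x y, star (x * y) = star y * star x].

Inductive penrose_index := P1 | P2 | P3 | P4.

Section StarRing.
Variables (R : nzRingType) (star : R -> R).
Implicit Types x y z : R.

Definition penrose (i : penrose_index) x y : Prop :=
  match i with
  | P1 => x * y * x = x
  | P2 => y * x * y = y
  | P3 => star (x * y) = x * y
  | P4 => star (y * x) = y * x
  end.

(* [ginv [:: i; ...; j] x] is the set x{i, ..., j}. *)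
Fixpoint ginv (s : seq penrose_index) x : set R :=
  if s is i :: s' then penrose i x `&` ginv s' x else setT.

Definition MP_invertible x : Prop := ginv [:: P1; P2; P3; P4] x !=set0.

(* The Moore-Penrose inverse, made total: 0 when x has none. *)
Definition dagger x : R := xget 0 (ginv [:: P1; P2; P3; P4] x).

Definition left_star_cancellable x : Prop :=
  forall z, star x * x * z = 0 -> x * z = 0.

Definition right_star_cancellable x : Prop :=
  forall z, z * x * star x = 0 -> z * x = 0.

Definition right_ideal x : set R := range (fun r => x * r).

Definition hermitian_elt x : Prop := star x = x.

Definition EP x : Prop := right_ideal x = right_ideal (star x).

End StarRing.

Lemma MP_unique (R : nzRingType) (star : R -> R) (x y z : R) :
  ring_involution star ->
  ginv star [:: P1; P2; P3; P4] x y -> ginv star [:: P1; P2; P3; P4] x z ->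
  y = z.
Proof.
move=> [_ _ sM] [/= y1 [y2 [y3 [y4 _]]]] [/= z1 [z2 [z3 [z4 _]]]].
have xyz : x * y = x * z.
  by rewrite -y3 -{1}z1 -mulrA sM y3 z3 mulrA y1.
have yzx : y * x = z * x.
  by rewrite -y4 -{1}z1 -mulrA mulrA sM z4 y4 -mulrA (mulrA x) y1.
by rewrite -y2 yzx -mulrA xyz mulrA z2.
Qed.

Lemma daggerP (R : nzRingType) (star : R -> R) (x y : R) :
  ring_involution star ->
  MP_invertible star x /\ dagger star x = y <->
  ginv star [:: P1; P2; P3; P4] x y.
Proof.
move=> sI; split=> [[[z xz] <-]|xy]; first exact: (xgetI 0 xz).
split; first by exists y.
exact: (MP_unique sI (xgetI 0 xy) xy).
Qed.

(* Main.v *)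
(** Put [M = abc] and [N = c124 bt a123].  Then [p = a123 M c124], [q = c N a],
[star a a p q = star a (MN) a] and [q p c star c = c (NM) star c].  As
[M = (a a123) M = M (c124 c)] and [N = (c124 c) N = N (a a123)], the outer
factors can be cancelled, so every condition on [p] and [q] becomes one on [M]
and [N].  For (iii), an EP idempotent is Hermitian; for (iv), [star N = M s] and
[star M = N t] with [MN] idempotent give [(1 - MN) M (star M) = 0], whence
[MNM = M] by cancellation; (v) is (iv) for the pair [(star N, star M)]. *)

Require Import Defs.
From HB Require Import structures.
From mathcomp Require Import all_boot all_algebra.
From mathcomp Require Import boolp classical_sets.
Set Implicit Arguments.
Unset Strict Implicit.
Unset Printing Implicit Defensive.
Import GRing.Theory.
Local Open Scope classical_set_scope.
Local Open Scope ring_scope.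

Section StarRingTheory.
Variables (R : nzRingType) (star : R -> R).
Hypothesis star_inv : ring_involution star.
Implicit Types e u v w x y : R.

Let starK : involutive star. Proof. by case: star_inv. Qed.

Let starM x y : star (x * y) = star y * star x. Proof. by case: star_inv. Qed.

Let star0 : star 0 = 0.
Proof.
have [_ starD _] := star_inv.
by apply: (addrI (star 0)); rewrite -starD !addr0.
Qed.

Lemma right_ideal_subP x y :
  right_ideal x `<=` right_ideal y <-> exists r, x = y * r.
Proof.
split=> [sub | [r ->] _ [s _ <-]]; last by exists (r * s) => //; rewrite mulrA.
by have [|r _ <-] := sub x; [exists 1; rewrite ?mulr1 | exists r].
Qed.

(** [u'] and [v'] need not invert [u] and [v]: it is enough that [u' * u] and [v * v'] act as
    identities on [x] and [y]. *)
Lemma sandwich_inj u u' v v' x y :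
    u' * u * x = x -> u' * u * y = y -> x * v * v' = x -> y * v * v' = y ->
  u * x * v = u * y * v <-> x = y.
Proof.
move=> ux uy xv yv; split=> [/(congr1 (fun z => u' * z * v')) | -> //].
by rewrite !mulrA ux uy xv yv.
Qed.

(** The right factors may differ: since [x = x * v * v'], the elements [x * v] and [x] generate the
    same right ideal, and likewise for [y] and [w]. *)
Lemma right_ideal_sub_cancel u u' x v v' y w w' :
    u' * u * x = x -> u' * u * y = y -> x * v * v' = x -> y * w * w' = y ->
  right_ideal (u * x * v) `<=` right_ideal (u * y * w) <->
  right_ideal x `<=` right_ideal y.
Proof.
move=> ux uy xv yw; rewrite !right_ideal_subP; split=> -[r].
  move=> /(congr1 (fun z => u' * z * v')); rewrite !mulrA ux xv uy => ->.
  by exists (w * r * v'); rewrite !mulrA.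
by move=> xr; exists (w' * r * v); rewrite xr -{1}yw !mulrA.
Qed.

(** The congruence by [u] is undone by the congruence by [u']; as [u' * u] is Hermitian, it fixes
    [star x] on both sides as soon as it fixes [x]. *)
Lemma hermitian_cancel u u' x :
    star (u' * u) = u' * u -> u' * u * x = x -> x * (u' * u) = x ->
  hermitian_elt star (u * x * star u) <-> hermitian_elt star x.
Proof.
rewrite /hermitian_elt => fh ux xu; rewrite !starM starK mulrA.
have sux : u' * u * star x = star x by rewrite -fh -starM xu.
have canc y : u' * u * y = y -> y * (u' * u) = y ->
    u' * (u * y * star u) * star u' = y.
  by move=> uy yu; rewrite !mulrA uy -mulrA -starM fh.
split=> [/(congr1 (fun z => u' * z * star u')) | -> //].
by rewrite !canc // -fh -starM ux.
Qed.

Lemma EP_cancel u u' x :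
    star (u' * u) = u' * u -> u' * u * x = x -> x * (u' * u) = x ->
  EP star (u * x * star u) <-> EP star x.
Proof.
move=> fh ux xu.
have sux : u' * u * star x = star x by rewrite -fh -starM xu.
have sxu : star x * (u' * u) = star x by rewrite -fh -starM ux.
have canc y z : u' * u * y = y -> u' * u * z = z ->
    y * (u' * u) = y -> z * (u' * u) = z ->
    right_ideal (u * y * star u) `<=` right_ideal (u * z * star u) <->
    right_ideal y `<=` right_ideal z.
  move=> uy uz yu zu.
  by apply: (right_ideal_sub_cancel (u' := u') (v' := star u') (w' := star u'));
     rewrite // -mulrA -starM fh.
rewrite /EP !starM starK mulrA.
by split=> /seteqP[? ?]; apply/seteqP; split; apply/canc.
Qed.

Lemma hermitian_mul_star e : e = e * star e -> hermitian_elt star e.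
Proof. by move=> ->; rewrite /hermitian_elt starM starK. Qed.

Lemma idempotent_EP e : e * e = e -> EP star e <-> hermitian_elt star e.
Proof.
move=> ee; split=> [/seteqP[/right_ideal_subP[r er] _] | he];
  last by rewrite /EP he.
(* [star e] is idempotent, hence fixes everything in its right ideal, in particular [e]; and
   [star e * e] is self-adjoint. *)
have ese : star e * e = e by rewrite {2}er mulrA -starM ee -er.
by move: (congr1 star ese); rewrite starM starK ese => /esym.
Qed.

Lemma ginv1234P x y :
  ginv star [:: P1; P2; P3; P4] x y <->
  [/\ ginv star [:: P1; P2] x y, hermitian_elt star (x * y) &
      hermitian_elt star (y * x)].
Proof. by split=> [[? [? [? [? _]]]] | [[? [? _]] ? ?]]. Qed.

Lemma MP_right_ideals x y : right_star_cancellable star x ->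
  ginv star [:: P1; P2; P3; P4] x y <->
  [/\ x * y = (x * y) ^+ 2, right_ideal (star y) `<=` right_ideal x &
      right_ideal (star x) `<=` right_ideal y].
Proof.
move=> xcanc; rewrite !(propext (right_ideal_subP _ _)) expr2.
split=> [[xyx [yxy [xyh [yxh _]]]] | [xyxy [s ys] [t xt]]].
  rewrite /= in xyx yxy xyh yxh; split; first by rewrite mulrA xyx.
    by exists (y * star y); rewrite mulrA -xyh -starM mulrA yxy.
  by exists (x * star x); rewrite mulrA -yxh -starM mulrA xyx.
have xyx : x * y * x = x.
  apply/eqP; rewrite -subr_eq0 -{3}[x]mul1r -mulrBl; apply/eqP/xcanc.
  by rewrite -mulrA xt !mulrBl mul1r !mulrA -(mulrA (x * y)) -xyxy subrr.
(* [star y] lies in the right ideal of [x], so [x * y] fixes it on the left; apply [star]. Then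
   [x * y] equals [x * y * star (x * y)]. The same argument with [x] and [y] exchanged gives (4),
   once (2) is known. *)
have yE : y = y * star (x * y).
  by rewrite -{1}[y]starK ys -{1}xyx -mulrA -ys starM starK.
have xyh : star (x * y) = x * y.
  by apply: hermitian_mul_star; rewrite -mulrA -yE.
have yxy : y * x * y = y by rewrite -mulrA -xyh -yE.
have xE : x = x * star (y * x).
  by rewrite -{1}[x]starK xt -{1}yxy -mulrA -xt starM starK.
have yxh : star (y * x) = y * x.
  by apply: hermitian_mul_star; rewrite -mulrA -xE.
by do !split.
Qed.

(** Passing to [(star y, star x)] swaps equations (1) and (2) and preserves (3) and (4). *)
Lemma ginv1234_star x y :
  ginv star [:: P1; P2; P3; P4] (star y) (star x) <->
  ginv star [:: P1; P2; P3; P4] x y.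
Proof.
have dual v w : ginv star [:: P1; P2; P3; P4] v w ->
    ginv star [:: P1; P2; P3; P4] (star w) (star v).
  move=> [/= e1 [e2 [e3 [e4 _]]]].
  by do !split; rewrite //= -!starM ?e3 ?e4 // mulrA ?e1 ?e2.
by split=> /dual //; rewrite !starK.
Qed.

Lemma MP_right_ideals_dual x y : left_star_cancellable star y ->
  ginv star [:: P1; P2; P3; P4] x y <->
  [/\ x * y = (x * y) ^+ 2, right_ideal x `<=` right_ideal (star y) &
      right_ideal y `<=` right_ideal (star x)].
Proof.
move=> ycanc; rewrite -ginv1234_star MP_right_ideals => [|z].
  rewrite !starK -starM !expr2 -starM.
  by split=> -[xy ? ?]; split=> //; [apply: (can_inj starK) | rewrite -xy].
(* Right cancellability of [star y] is left cancellability of [y], applied to [star z]. *)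
rewrite starK => zyy.
rewrite -[z]starK -starM ycanc ?star0 // -mulrA -[y in _ * (y * _)]starK.
by rewrite -!starM zyy.
Qed.

End StarRingTheory.

Theorem theorem2p7 (R : nzRingType) (star : R -> R)
    (star_inv : ring_involution star)
    (a b c bt : R)
    (a13 : ginv star [:: P1; P3] a !=set0)
    (c14 : ginv star [:: P1; P4] c !=set0)
    (abc_canc : right_star_cancellable star (a * b * c))
    (a123 : R) (a123P : ginv star [:: P1; P2; P3] a a123)
    (c124 : R) (c124P : ginv star [:: P1; P2; P4] c c124)
    (cba_canc : left_star_cancellable star (c124 * bt * a123)) :
  let p := a123 * a * b * c * c124 in
  let q := c * c124 * bt * a123 * a in
  [<-> (* (i) *)
       MP_invertible star (a * b * c) /\
       dagger star (a * b * c) = c124 * bt * a123;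
       (* (ii) *)
       [/\ ginv star [:: P1; P2] p q,
           hermitian_elt star (star a * a * p * q) &
           hermitian_elt star (q * p * c * star c)];
       (* (iii) *)
       [/\ ginv star [:: P1; P2] p q,
           EP star (star a * a * p * q) &
           EP star (q * p * c * star c)];
       (* (iv) *)
       [/\ p * q = (p * q) ^+ 2,
           right_ideal (star q) `<=` right_ideal (star a * a * p) &
           right_ideal (c * star c * star p) `<=` right_ideal q];
       (* (v) *)
       [/\ p * q = (p * q) ^+ 2,
           right_ideal (star a * a * p) `<=` right_ideal (star q) &
           right_ideal q `<=` right_ideal (c * star c * star p)]].
Proof.
move=> p q.
have [starK _ starM] := star_inv.
have [aAa AaA aAh] : [/\ a * a123 * a = a, a123 * a * a123 = a123 &
    star (a * a123) = a * a123] by case: a123P => ? [? []].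
have [cCc CcC Cch] : [/\ c * c124 * c = c, c124 * c * c124 = c124 &
    star (c124 * c) = c124 * c] by case: c124P => ? [? []].
pose M := a * b * c; pose N := c124 * bt * a123.
have aM : a * a123 * M = M by rewrite /M !mulrA aAa.
have Mc : M * (c124 * c) = M by rewrite /M -!mulrA (mulrA c) cCc.
have Na : N * (a * a123) = N by rewrite /N -!mulrA (mulrA a123) AaA.
have cN : c124 * c * N = N by rewrite /N !mulrA CcC.
have Aa x : star a123 * star a * x = a * a123 * x by rewrite -starM aAh.
have pE : p = a123 * M * c124 by rewrite /p /M !mulrA.
have qE : q = c * N * a by rewrite /q /N !mulrA.
(* From here on [b] and [bt] are irrelevant: only [pE], [qE] and the absorption identities for [M]
   and [N] are used. *)
rewrite -/M -/N in abc_canc cba_canc *; clearbody M N p q.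
have Msa : star M * star a123 * star a = star M by rewrite -mulrA -!starM aM.
have sMc : c124 * c * star M = star M by rewrite -Cch -starM Mc.
have saN : star a123 * star a * star N = star N by rewrite -!starM Na.
have Nsc : star N * star c * star c124 = star N by rewrite -mulrA -!starM cN.
have pqE : p * q = a123 * (M * N) * a by rewrite pE qE -{2}Mc !mulrA.
have qpE : q * p = c * (N * M) * c124 by rewrite pE qE -{2}Na !mulrA.
have aMN : a * a123 * (M * N) = M * N by rewrite mulrA aM.
have MNa : M * N * (a * a123) = M * N by rewrite -mulrA Na.
have cNM : c124 * c * (N * M) = N * M by rewrite mulrA cN.
have NMc : N * M * (c124 * c) = N * M by rewrite -mulrA Mc.
(* The last factor [a] is written [star (star a)] to exhibit a congruence by [star a]. *)
have sapqE : star a * a * p * q = star a * (M * N) * star (star a).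
  by rewrite -mulrA pqE starK -{2}aMN !mulrA.
have qpscE : q * p * c * star c = c * (N * M) * star c.
  by rewrite qpE -{2}NMc !mulrA.
have sqE : star q = star a * star N * star c by rewrite qE !starM mulrA.
have sapE : star a * a * p = star a * M * c124 by rewrite pE -{2}aM !mulrA.
(* The inner [star c * star c124] is [c124 * c] by (4), which [star M] absorbs. *)
have cspE : c * star c * star p = c * star M * star a123.
  by rewrite pE !starM -{2}sMc -Cch starM !mulrA.
have idemE : p * q = (p * q) ^+ 2 <-> M * N = (M * N) ^+ 2.
  have -> : (p * q) ^+ 2 = a123 * (M * N) ^+ 2 * a.
    by rewrite pqE !expr2 -{4}aMN !mulrA.
  rewrite pqE.
  apply: (sandwich_inj (u' := a) (v' := a123)) => //.
  - by rewrite expr2 mulrA aMN.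
  - by rewrite -mulrA MNa.
  - by rewrite expr2 -(mulrA _ a) -(mulrA (M * N)) MNa.
have ginv12E : ginv star [:: P1; P2] p q <-> ginv star [:: P1; P2] M N.
  have pqpE : p * q * p = a123 * (M * N * M) * c124.
    by rewrite pqE pE -{4}aM !mulrA.
  have qpqE : q * p * q = c * (N * M * N) * a.
    by rewrite qpE qE -{4}cN !mulrA.
  have pqpP : p * q * p = p <-> M * N * M = M.
    rewrite pqpE [X in _ = X]pE.
    apply: (sandwich_inj (u' := a) (v' := c)) => //.
    - by rewrite mulrA aMN.
    - by rewrite -(mulrA _ c124) -(mulrA (M * N)) Mc.
    - by rewrite -mulrA.
  have qpqP : q * p * q = q <-> N * M * N = N.
    rewrite qpqE [X in _ = X]qE.
    apply: (sandwich_inj (u' := c124) (v' := a123)) => //.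
    - by rewrite mulrA cNM.
    - by rewrite -(mulrA _ a) -(mulrA (N * M)) Na.
    - by rewrite -mulrA.
  by split=> -[/pqpP ? [/qpqP ? _]].
(* Here [u' * u] is [star a123 * star a], equal to [a * a123] by (3); for [N * M] below it is
   [c124 * c], Hermitian by (4). *)
have hMN : hermitian_elt star (star a * a * p * q) <->
    hermitian_elt star (M * N).
  rewrite sapqE; apply: (hermitian_cancel star_inv (u' := star a123));
  by rewrite -starM aAh.
have hNM : hermitian_elt star (q * p * c * star c) <->
    hermitian_elt star (N * M).
  by rewrite qpscE; apply: (hermitian_cancel star_inv (u' := c124)).
have EPMN : EP star (star a * a * p * q) <-> EP star (M * N).
  rewrite sapqE; apply: (EP_cancel star_inv (u' := star a123));
  by rewrite -starM aAh.
have EPNM : EP star (q * p * c * star c) <-> EP star (N * M).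
  by rewrite qpscE; apply: (EP_cancel star_inv (u' := c124)).
have NM_sub : right_ideal (star q) `<=` right_ideal (star a * a * p) <->
    right_ideal (star N) `<=` right_ideal M.
  rewrite sqE sapE.
  apply: (right_ideal_sub_cancel (u' := star a123) (v' := star c124)
                                 (w' := c)) => //.
    by rewrite Aa.
  by rewrite -mulrA.
have MN_sub : right_ideal (star a * a * p) `<=` right_ideal (star q) <->
    right_ideal M `<=` right_ideal (star N).
  rewrite sqE sapE.
  apply: (right_ideal_sub_cancel (u' := star a123) (v' := c)
                                 (w' := star c124)) => //.
    by rewrite Aa.
  by rewrite -mulrA.
have sMN_sub : right_ideal (c * star c * star p) `<=` right_ideal q <->
    right_ideal (star M) `<=` right_ideal N.
  rewrite cspE qE.
  apply: (right_ideal_sub_cancel (u' := c124) (v' := star a)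
                                 (w' := a123)) => //.
  by rewrite -mulrA.
have NsM_sub : right_ideal q `<=` right_ideal (c * star c * star p) <->
    right_ideal N `<=` right_ideal (star M).
  rewrite cspE qE.
  apply: (right_ideal_sub_cancel (u' := c124) (v' := a123)
                                 (w' := star a)) => //.
  by rewrite -mulrA.
have i_iff := daggerP M N star_inv.
have iv_iff := MP_right_ideals star_inv N abc_canc.
have v_iff := MP_right_ideals_dual star_inv M cba_canc.
(* After these rewrites (i), (ii), (iv) and (v) are the same proposition, that [N] satisfies all
   four equations for [M]; only (iii) remains. *)
rewrite (propext i_iff) (propext ginv12E) (propext idemE) (propext hMN).
rewrite (propext hNM) (propext EPMN) (propext EPNM) (propext NM_sub).
rewrite (propext MN_sub) (propext sMN_sub) (propext NsM_sub).
rewrite -(propext iv_iff) -(propext v_iff) -(propext (ginv1234P star M N)).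
have iii_iff : [/\ ginv star [:: P1; P2] M N, EP star (M * N) &
    EP star (N * M)] <-> ginv star [:: P1; P2; P3; P4] M N.
  rewrite ginv1234P; split=> -[/[dup] MN [MNM [NMN _]] hx hy]; split=> //;
  by apply/(idempotent_EP star_inv) => //; rewrite mulrA ?MNM ?NMN.
by rewrite (propext iii_iff); tfae.
Qed.
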